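(* Let $u$ be a uniformly recurrent infinite word over a finite alphabet with no weak bispecial factor, and let $m\in\mathbb N$. Then $u$ has property $R_m$ (every factor of $u$ has exactly $m$ return words) if and only if $C(n)=(m-1)n+1$ for all $n\ge 0$.
   Context: Let $u=u_0u_1\cdots$ be an infinite word over a finite alphabet $\mathcal A$. Factors are finite (possibly empty) words occurring in $u$; $C(n)$ is the number of factors of length $n$. $u$ is uniformly recurrent if for every $n$ every sufficiently long factor contains all factors of length $n$. For a factor $w$, $\mathcal E_\ell(w)=\{a\in\mathcal A: aw \text{ is a factor}\}$, $\mathcal E_r(w)=\{b\in\mathcal A: wb\text{ is a factor}\}$. If $j<k$ are successive occurrences of $w$ (positions $j$ with $u_j\cdots u_{j+|w|-1}=w$), then $u_j\cdots u_{k-1}$ is a return word of $w$. The bilateral order of $w$ is $B(w)=\#\{awb \text{ factor of } u: a,b\in\mathcal A\}-\#\mathcal E_\ell(w)-\#\mathcal E_r(w)+1$, and $w$ is weak bispecial if $B(w)<0$. *)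

(* Defs.v *)
From mathcomp Require Import all_boot all_order all_algebra.
From mathcomp Require Import boolp classical_sets functions cardinality.

Set Implicit Arguments.
Unset Strict Implicit.
Unset Printing Implicit Defensive.

Import GRing.Theory Num.Theory.

Section InfiniteWords.
Variable A : finType.
Implicit Types (u : nat -> A) (v w : seq A).

(* u_j u_{j+1} ... u_{j+n-1} *)
Definition subword u (j n : nat) : seq A := mkseq (fun i => u (j + i)) n.

Definition occurs u w (j : nat) : bool := subword u j (size w) == w.

Definition factor u w : Prop := exists j, occurs u w j.

Definition complexity u (n : nat) : nat :=
  #|[set w : n.-tuple A | `[< factor u w >]]|.

Definition uniformly_recurrent u : Prop :=
  forall n, exists N, forall w, factor u w -> N <= size w ->
    forall v, factor u v -> size v = n -> infix v w.

Definition left_ext u w : {set A} := [set a | `[< factor u (a :: w) >]].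

Definition right_ext u w : {set A} := [set b | `[< factor u (rcons w b) >]].

Definition both_ext u w : {set A * A} :=
  [set p | `[< factor u (p.1 :: rcons w p.2) >]].

Definition bilateral_order u w : int :=
  (#|both_ext u w|%:Z - #|left_ext u w|%:Z - #|right_ext u w|%:Z + 1)%R.

Definition weak_bispecial u w : Prop :=
  factor u w /\ (bilateral_order u w < 0)%R.

Definition successive_occurrences u w (j k : nat) : Prop :=
  [/\ j < k, occurs u w j, occurs u w k &
      forall i, j < i < k -> ~~ occurs u w i].

Definition return_words u w : set (seq A) :=
  [set v | exists j k,
     successive_occurrences u w j k /\ v = subword u j (k - j)]%classic.

(* Equipotence with `I_m = {0, ..., m-1} forces the set of return words to be
   finite; the empty word counts as a factor, its return words being the
   letters of u. *)
Definition property_R u (m : nat) : Prop :=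
  forall w, factor u w -> (return_words u w #= `I_m)%card.

End InfiniteWords.

(* Main.v *)
(* Let s(n) = C(n+1) - C(n) and let #E_r(y) - 1 be the branching of a factor y,
   so that s(n) is the total branching of the factors of length n. When no
   factor is weak bispecial, the branching of y is at most the sum of the
   branchings of its left extensions; in particular s is nondecreasing.
   The words that contain w exactly once, as a prefix, form a finite tree under
   right extension, whose leaves are the complete return words of w; hence
   R(w) - 1, where R(w) is the number of return words of w, is the total
   branching of this tree. Extending all factors of length |w| to the left
   until w is reached turns them into the nodes of the tree, and extending these
   nodes further to the left, up to a length L such that all factors of length L
   contain w, gives distinct factors of length L. By superadditivity,
   s(|w|) <= R(w) - 1 <= s(L). For the empty word one may take L = 0, so that
   R(empty) - 1 = s(0). Both implications follow. *)
Require Import Defs.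
From mathcomp Require Import all_boot all_order all_algebra.
From mathcomp Require Import boolp classical_sets functions cardinality.
From mathcomp Require Import zify.

Set Implicit Arguments.
Unset Strict Implicit.
Unset Printing Implicit Defensive.

Import Order.TTheory GRing.Theory Num.Theory.

(** * Cardinality of listed sets and integer sums *)

Lemma card_eq_size_uniq (T : eqType) (s : seq T) :
  uniq s -> ([set` s] #= `I_(size s))%card.
Proof.
(* A nonempty list supplies [x0] as the default value of [nth]. *)
case: s => [|x0 s] us.
  by rewrite II0 card_eq0; apply/eqP; rewrite -subset0.
move: (x0 :: s) us => t us.
have -> : ([set` t] = nth x0 t @` `I_(size t))%classic.
  apply/seteqP; split=> [x /= xt | _ [i /= ilt <-]]; last exact: mem_nth.
  by exists (index x t); [rewrite /= index_mem | exact: nth_index].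
apply: inj_card_eq => i j /set_mem /= ilt /set_mem /= jlt /eqP.
by rewrite nth_uniq // => /eqP.
Qed.

Lemma Posz_sum (I : Type) (r : seq I) (P : pred I) (F : I -> nat) :
  Posz (\sum_(i <- r | P i) F i)%N = (\sum_(i <- r | P i) (F i)%:Z)%R.
Proof. exact: (big_morph Posz PoszD erefl). Qed.

(** * Subwords and factors *)

Section Factors.
Variables (A : finType) (u : nat -> A).
Implicit Types (v w x y : seq A) (a b : A) (i j k l n : nat).

Lemma size_subword j n : size (subword u j n) = n.
Proof. exact: size_mkseq. Qed.

Lemma subwordS j n : subword u j n.+1 = u j :: subword u j.+1 n.
Proof.
rewrite /subword /mkseq /= addn0 -[1]addn0 iotaDl -map_comp; congr (_ :: _).
by apply: eq_map => i /=; rewrite add1n addSnnS.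
Qed.

Lemma subwordD j n l :
  subword u j (n + l) = subword u j n ++ subword u (j + n) l.
Proof.
elim: n j => [|n IHn] j; first by rewrite addn0.
by rewrite addSn !subwordS IHn addSnnS.
Qed.

Lemma take_subword j n l : n <= l -> take n (subword u j l) = subword u j n.
Proof.
by move=> nl; rewrite -(subnKC nl) subwordD take_size_cat // size_subword.
Qed.

Lemma prefix_subword w j l :
  prefix w (subword u j l) = (size w <= l) && occurs u w j.
Proof.
apply/idP/andP => [pw | [wl /eqP ow]].
  have wl : size w <= l by rewrite -(size_subword j l) size_prefix.
  by move: pw; rewrite prefixE take_subword.
by rewrite prefixE take_subword // ow.
Qed.

Lemma infix_subwordP w j l :
  reflect (exists i, [/\ j <= i, i + size w <= j + l & occurs u w i])
          (infix w (subword u j l)).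
Proof.
apply: (iffP idP) => [|[i [ji il ow]]].
  elim: l j => [|l IHl] j.
    by rewrite infixs0 => /eqP ->; exists j; rewrite addn0 leqnn.
  rewrite subwordS infix_consl -subwordS prefix_subword => /orP[/andP[wl ow]|].
    by exists j; rewrite leqnn leq_add2l.
  by move=> /IHl[i [ji il ow]]; exists i; split=> //; lia.
have -> : l = (i - j) + (l - (i - j)) by lia.
rewrite subwordD subnKC // infix_catl // prefixW // prefix_subword ow andbT.
by lia.
Qed.

Lemma factorP y : factor u y <-> exists j, y = subword u j (size y).
Proof. by split=> -[j yE]; exists j; [apply/esym/eqP | apply/eqP/esym]. Qed.

Lemma factor_subword j n : factor u (subword u j n).
Proof. by apply/factorP; exists j; rewrite size_subword. Qed.

Lemma factor_behead y : factor u y -> factor u (behead y).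
Proof.
case: y => // a y /factorP[j]; rewrite subwordS => -[_ ->].
exact: factor_subword.
Qed.

Lemma factor_take n y : factor u y -> factor u (take n y).
Proof.
move=> /factorP[j yE]; have [ny|/ltnW yn] := leqP n (size y).
  by rewrite yE take_subword //; exact: factor_subword.
by rewrite take_oversize // yE; exact: factor_subword.
Qed.

(** * Enumeration of the factors of a given length *)

Definition factors n : seq (seq A) :=
  [seq tval t | t <- enum [set w : n.-tuple A | `[< factor u w >]]].

Lemma size_factors n : size (factors n) = complexity u n.
Proof. by rewrite size_map -cardE. Qed.

Lemma uniq_factors n : uniq (factors n).
Proof. by rewrite map_inj_uniq ?enum_uniq //; exact: val_inj. Qed.

Lemma mem_factors n y : (y \in factors n) = (size y == n) && `[< factor u y >].
Proof.
apply/mapP/andP => [[t] | [yn fy]].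
  by rewrite mem_enum inE => ft ->; rewrite size_tuple.
by exists (Tuple yn); rewrite // mem_enum inE.
Qed.

Lemma perm_factors_cons n :
  perm_eq (factors n.+1)
          [seq a :: y | y <- factors n, a <- enum (left_ext u y)].
Proof.
apply: uniq_perm; first exact: uniq_factors.
  apply: allpairs_uniq_dep; first exact: uniq_factors.
    by move=> y _; exact: enum_uniq.
  by move=> [y a] [z b] _ _ /= [-> ->].
move=> x; apply/idP/allpairsPdep => [|[y [a [yn +]]]].
  case: x => [|a y]; rewrite mem_factors // eqSS => /andP[yn /asboolP fy].
  exists y, a; rewrite mem_factors yn mem_enum inE; split=> //.
    exact: (factor_behead fy).
  by rewrite inE; exact: asboolT.
rewrite mem_enum inE => fy ->.
move: yn; rewrite !mem_factors => /andP[/eqP yn _].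
by rewrite /= yn eqxx.
Qed.

Lemma perm_factors_rcons n :
  perm_eq (factors n.+1)
          [seq rcons y b | y <- factors n, b <- enum (right_ext u y)].
Proof.
apply: uniq_perm; first exact: uniq_factors.
  apply: allpairs_uniq_dep; first exact: uniq_factors.
    by move=> y _; exact: enum_uniq.
  by move=> [y a] [z b] _ _ /= /rcons_inj[-> ->].
move=> x; apply/idP/allpairsPdep => [|[y [b [yn +]]]].
  case/lastP: x => [|y b]; rewrite mem_factors // size_rcons eqSS.
  move=> /andP[yn /asboolP fy].
  exists y, b; rewrite mem_factors yn mem_enum inE; split=> //; last first.
    by rewrite inE; exact: asboolT.
  by rewrite -[y](take_size_cat [:: b] erefl) cats1; exact: factor_take.
rewrite mem_enum inE => fy ->.
move: yn; rewrite !mem_factors => /andP[/eqP yn _].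
by rewrite size_rcons yn eqxx.
Qed.

Local Open Scope ring_scope.

Lemma sum_factors_cons n (P : pred (seq A)) (F : seq A -> int) :
  \sum_(x <- factors n.+1 | P (behead x)) F x =
  \sum_(y <- factors n | P y) \sum_(a in left_ext u y) F (a :: y).
Proof.
rewrite (perm_big _ (perm_factors_cons n)) big_mkcond big_allpairs_dep /=.
rewrite [RHS]big_mkcond; apply: eq_bigr => y _.
by case: (P y); [rewrite big_enum | rewrite big1].
Qed.

Lemma sum_factors_rcons n (P : pred (seq A)) (F : seq A -> int) :
  \sum_(x <- factors n.+1 | P (take n x)) F x =
  \sum_(y <- factors n | P y) \sum_(b in right_ext u y) F (rcons y b).
Proof.
rewrite (perm_big _ (perm_factors_rcons n)) big_mkcond big_allpairs_dep /=.
(* Membership is kept in the sums because [take n (rcons y b) = y] needs [size y = n]. *)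
rewrite [RHS]big_mkcond [LHS]big_seq [RHS]big_seq; apply: eq_bigr => y.
rewrite mem_factors => /andP[/eqP yn _].
under eq_bigr do rewrite -cats1 take_size_cat //.
case: (P y); last by rewrite big1.
by rewrite big_enum; under eq_bigr do rewrite cats1.
Qed.

Lemma eq_sum_factors n (P Q : pred (seq A)) (F : seq A -> int) :
  (forall y, size y = n -> factor u y -> P y = Q y) ->
  \sum_(y <- factors n | P y) F y = \sum_(y <- factors n | Q y) F y.
Proof.
move=> PQ; rewrite big_seq_cond [RHS]big_seq_cond; apply: eq_bigl => y.
case: (boolP (y \in _)) => //=; rewrite mem_factors.
by move=> /andP[/eqP yn /asboolP]; exact: PQ.
Qed.

(** * Branching and its superadditivity *)

Definition branching y : int := #|right_ext u y|%:Z - 1.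

(** The right extensions of the factors [y] with [P y] are the factors of length [n + 1] whose first
    [n] letters satisfy [P]; each [y] contributes its number of extensions minus one. *)
Lemma sum_branching n (P : pred (seq A)) :
  \sum_(y <- factors n | P y) branching y =
  (count (P \o take n) (factors n.+1))%:Z - (count P (factors n))%:Z.
Proof.
rewrite /branching sumrB -!sum1_count !Posz_sum; congr (_ - _).
rewrite sum_factors_rcons; apply: eq_bigr => y _.
by rewrite -Posz_sum sum1_card.
Qed.

Lemma sum_branching_factors n :
  \sum_(y <- factors n) branching y =
  (complexity u n.+1)%:Z - (complexity u n)%:Z.
Proof. by rewrite sum_branching -!size_factors !count_predT. Qed.

Lemma complexity0 : complexity u 0 = 1%N.
Proof.
rewrite -size_factors.
have /perm_size -> // : perm_eq (factors 0) [:: [::]].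
apply: uniq_perm => [||y]; rewrite ?uniq_factors // mem_factors inE size_eq0.
by case: eqP => //= ->; apply/asboolP; exact: (factor_subword 0 0).
Qed.

Hypothesis noweak : forall w, ~ weak_bispecial u w.

Lemma card_both_ext w :
  #|both_ext u w| = (\sum_(a in left_ext u w) #|right_ext u (a :: w)|)%N.
Proof.
under eq_bigr do rewrite -sum1_card.
rewrite pair_big_dep -sum1_card; apply: eq_bigl => -[a b]; rewrite !inE /=.
apply/idP/andP => [fab|[]//]; split=> //; apply: asboolT; move/asboolP: fab.
rewrite -rcons_cons => /(factor_take (size (a :: w))).
by rewrite -cats1 take_size_cat.
Qed.

(** The difference of the two sides is exactly $B(w)$, once the words $awb$ are counted letter $a$
    by letter $a$. *)
Lemma branching_left_ext w : factor u w ->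
  branching w <= \sum_(a in left_ext u w) branching (a :: w).
Proof.
move=> fw; have : 0 <= bilateral_order u w.
  by rewrite leNgt; apply/negP => B; exact: (@noweak w).
rewrite /bilateral_order card_both_ext /branching sumrB -Posz_sum.
by rewrite -[\sum_(_ in _) 1%R]Posz_sum sum1_card; lia.
Qed.

Lemma sum_branching_left n (P : pred (seq A)) :
  \sum_(y <- factors n | P y) branching y <=
  \sum_(x <- factors n.+1 | P (behead x)) branching x.
Proof.
rewrite sum_factors_cons [X in X <= _]big_seq_cond [X in _ <= X]big_seq_cond.
apply: ler_sum => y /andP[]; rewrite mem_factors => /andP[_ /asboolP fy] _.
exact: branching_left_ext.
Qed.

(** * Nodes of the tree of a factor *)

(* w occurs in y exactly once, as a prefix. *)
Definition only_prefix w y : bool :=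
  if y is _ :: y' then infix w y && ~~ infix w y' else nilp w.

(** Nonemptiness excludes [w = y = [::]], where [behead y] still contains [w]. *)
Lemma only_prefixE w y : (0 < size y)%N ->
  only_prefix w y = infix w y && ~~ infix w (behead y).
Proof. by case: y. Qed.

Lemma only_prefix_subword w j l :
  only_prefix w (subword u j l) <->
  [/\ (size w <= l)%N, occurs u w j &
      forall i, (j < i)%N -> (i + size w <= j + l)%N -> ~~ occurs u w i].
Proof.
case: l => [|l].
  split=> [/nilP -> | [+ _ _]]; last by rewrite leqn0.
  by rewrite /occurs eqxx; split=> // i /=; lia.
rewrite only_prefixE ?size_subword // subwordS [behead _]/= infix_consl.
rewrite -subwordS prefix_subword; split=> [/andP[pw npw] | [wl ow now]].
  move: pw; rewrite (negPf npw) orbF => /andP[wl ow]; split=> // i ji il.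
  apply/negP => oi; move/negP: npw; apply; apply/infix_subwordP.
  by exists i; rewrite addSnnS.
rewrite wl ow /=; apply/infix_subwordP => -[i [ji il oi]].
by move: (now i ji); rewrite -addSnnS il oi => /(_ isT).
Qed.

Lemma only_prefix_size w y : factor u y -> size y = size w ->
  only_prefix w y = (y == w).
Proof.
move=> /factorP[j ->]; rewrite size_subword => yw; apply/idP/idP.
  by move/only_prefix_subword => [_]; rewrite /occurs yw.
rewrite yw => ow; apply/only_prefix_subword; split=> // i; lia.
Qed.

Lemma infix_only_prefix_size w y : size y = size w ->
  infix w y = only_prefix w y.
Proof.
case: y => [|a y] yw; first by rewrite infixs0 -size_eq0.
apply/idP/andP => [iw|[]//]; split=> //; apply/negP => /size_infix.
by rewrite -yw ltnn.
Qed.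

(** * Leaves of the tree: complete return words *)

(* Meant for words y of length l + 1, so that take l removes the last letter. *)
Definition complete_return w l y : bool :=
  only_prefix w (take l y) && ~~ only_prefix w y.

(** Here [k + 1] is the length of the return word: the factor of length [size w + k + 1] at [j] ends
    where the occurrence of [w] at [j + k + 1] ends. *)
Lemma complete_return_subword w j k :
  complete_return w (size w + k) (subword u j (size w + k).+1) <->
  successive_occurrences u w j (j + k.+1).
Proof.
rewrite /complete_return take_subword //; split=> [/andP[]|[_ ow ow' now]].
  move=> /only_prefix_subword[_ ow now] /negP new.
  have now' i : (j < i < j + k.+1)%N -> ~~ occurs u w i.
    by move=> /andP[ji ik]; apply: now => //; lia.
  split=> //; first lia.
  apply/negPn/negP => ow'; apply: new; apply/only_prefix_subword.
  split=> // [|i ji ik]; first lia.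
  (* The last letter completes only one new position for [w], namely [j + k + 1]. *)
  by have [->//|ne] := eqVneq i (j + k.+1)%N; apply: now'; lia.
apply/andP; split.
  by apply/only_prefix_subword; split=> // [|i ji ik]; [lia | apply: now; lia].
apply/negP => /only_prefix_subword[_ _ new].
suff : ~~ occurs u w (j + k.+1) by rewrite ow'.
by apply: new; lia.
Qed.

(** Hence cutting off the final [w] is injective on complete return words. *)
Lemma complete_return_suffix w k y : factor u y -> size y = (size w + k).+1 ->
  complete_return w (size w + k) y -> y = take (size y - size w) y ++ w.
Proof.
move=> /factorP[j yE] yk; rewrite yE yk.
move/complete_return_subword => [_ _ /eqP ow _].
have -> : (size w + k).+1 = (k.+1 + size w)%N by lia.
rewrite size_subword addnK subwordD take_size_cat ?size_subword // ow.
by [].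
Qed.

(** The leaves at depths 1 to [K] below the root [w]. *)
Definition complete_returns w K : seq (seq A) :=
  [seq y | k <- iota 0 K,
           y <- [seq y <- factors (size w + k).+1 |
                   complete_return w (size w + k) y]].

Lemma uniq_complete_returns w K : uniq (complete_returns w K).
Proof.
apply: allpairs_uniq_dep => [|k _|]; first exact: iota_uniq.
  by rewrite filter_uniq ?uniq_factors.
move=> _ q /allpairsPdep[k [y [_ ymem ->]]].
move=> /allpairsPdep[l [z [_ zmem ->]]] /= yz.
move: ymem zmem; rewrite !mem_filter !mem_factors.
move=> /and3P[_ /eqP yk _] /and3P[_ /eqP zl _].
by move: zl; rewrite -yz yk => -[/addnI <-].
Qed.

Lemma mem_complete_returns w K y :
  reflect (exists k, [/\ (k < K)%N, size y = (size w + k).+1, factor u y &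
                         complete_return w (size w + k) y])
          (y \in complete_returns w K).
Proof.
apply: (iffP allpairsPdep) => [[k [z [kK + ->]]] | [k [kK yk fy cy]]].
  move: kK; rewrite mem_iota mem_filter mem_factors /= => kK.
  move=> /and3P[cy /eqP yk /asboolP fy].
  by exists k.
exists k, y; rewrite mem_iota mem_filter mem_factors cy yk eqxx.
by split=> //; exact: asboolT.
Qed.

Lemma card_return_words w K :
  (forall y, factor u y -> only_prefix w y -> (size y < size w + K)%N) ->
  (return_words u w #= `I_(size (complete_returns w K)))%card.
Proof.
move=> bound; set t := fun y => take (size y - size w) y.
have -> : (return_words u w = t @` [set` complete_returns w K])%classic.
  apply/seteqP; split=> [_ [j [k [jk ->]]] | _ [y /= + <-]].
    have [ltjk _ _ _] := jk; set l := (k - j).-1.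
    have kE : k = (j + l.+1)%N by lia.
    move: jk; rewrite kE => /complete_return_subword cr.
    exists (subword u j (size w + l).+1).
      apply/mem_complete_returns; exists l.
      split=> //; last exact: factor_subword.
        (* Without its last letter a complete return word is a node, so the bound on nodes gives
           [l < K]. *)
        have /andP[pl _] := cr; move: pl; rewrite take_subword // => pl.
        have := bound _ (factor_subword _ _) pl.
        by rewrite size_subword ltn_add2l.
      by rewrite size_subword.
    by rewrite /t size_subword take_subword ?leq_subr //; congr subword; lia.
  move=> /mem_complete_returns[k [_ yk /factorP[j yE] cy]].
  exists j, (j + k.+1)%N; split.
    by apply/complete_return_subword; rewrite -yk -yE.
  by rewrite /t yk yE yk take_subword; [congr subword; lia | lia].
have tE y : y \in complete_returns w K -> y = t y ++ w.
  move=> /mem_complete_returns[k [_ yk fy cy]].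
  exact: complete_return_suffix yk cy.
apply: card_eq_trans (card_eq_size_uniq (uniq_complete_returns w K)).
apply: inj_card_eq => y z /set_mem /= /tE yE /set_mem /= /tE zE tyz.
by rewrite yE zE tyz.
Qed.

(** * Total branching of the tree *)

(** Each level contributes its children minus its nodes. A child is a node of the next level or a
    leaf, so the node counts telescope; the final [- 1] is the root. *)
Lemma sum_branching_only_prefix w K : factor u w ->
  \sum_(k < K) \sum_(y <- factors (size w + k) | only_prefix w y) branching y =
  (count (only_prefix w) (factors (size w + K)))%:Z
  + (size (complete_returns w K))%:Z - 1.
Proof.
move=> fw.
have cardw : count (only_prefix w) (factors (size w)) = 1%N.
  rewrite (@eq_in_count _ _ (pred1 w)) => [|y].
    rewrite count_uniq_mem ?uniq_factors // mem_factors eqxx.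
    by rewrite asboolT.
  by rewrite mem_factors => /andP[/eqP yw /asboolP fy]; exact: only_prefix_size.
rewrite size_allpairs_dep sumnE big_map.
elim: K => [|K IHK]; first by rewrite big_ord0 big_nil addn0 cardw.
have -> : iota 0 K.+1 = rcons (iota 0 K) K by rewrite -cats1 -addn1 iotaD.
rewrite big_ord_recr big_rcons {}IHK /=.
rewrite sum_branching addnS size_filter.
set N := count _ (factors (size w + K)); set S := (\sum_(_ <- _) _)%N.
suff -> : count (only_prefix w \o take (size w + K)) (factors (size w + K).+1) =
  (count (only_prefix w) (factors (size w + K).+1) +
   count [eta complete_return w (size w + K)] (factors (size w + K).+1))%N
  by lia.
rewrite -count_predUI (@eq_count _ (predI _ _) pred0) => [|y]; last first.
  by rewrite /= /complete_return; case: (only_prefix w y); rewrite ?andbF.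
rewrite count_pred0 addn0; apply: eq_in_count => y.
rewrite mem_factors => /andP[/eqP yl /asboolP /factorP[j yE]].
rewrite /= /complete_return.
case: (boolP (only_prefix w y)); rewrite ?andbT //=.
(* The parent of a node is a node: [w] already fits into the first [size w + K] letters. *)
rewrite yE yl take_subword // => /only_prefix_subword[_ ow now].
by apply/only_prefix_subword; split=> // [|i ji ik]; [lia | apply: now; lia].
Qed.

(** * Extension to the left *)

(** A left extension of a word without [w] either still avoids [w] or contains it only as a
    prefix. *)
Lemma sum_branching_free_le w n :
  \sum_(y <- factors n | ~~ infix w y) branching y <=
  \sum_(y <- factors n.+1 | ~~ infix w y) branching y +
  \sum_(y <- factors n.+1 | only_prefix w y) branching y.
Proof.
apply: le_trans (sum_branching_left _ _) _.
rewrite (bigID (infix w)) /= addrC.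
rewrite (@eq_sum_factors _ _ [pred y | ~~ infix w y]) => [|[|a y] //= _ _].
  rewrite lerD2l [leLHS](@eq_sum_factors _ _ (only_prefix w)) //.
  by move=> [|a y] //= _ _; rewrite andbC.
by rewrite negb_or andbC -andbA andbb.
Qed.

(** Left extensions of words containing [w] have a tail containing [w], whereas nodes of length
    [n + 1] have a tail without [w]; the two families are disjoint. *)
Lemma sum_branching_infix_le w n :
  \sum_(y <- factors n | infix w y) branching y +
  \sum_(y <- factors n.+1 | only_prefix w y) branching y <=
  \sum_(y <- factors n.+1 | infix w y) branching y.
Proof.
rewrite [X in _ <= X](bigID (infix w \o behead)) /=.
have -> : \sum_(y <- factors n.+1 | infix w y && infix w (behead y)) branching y
        = \sum_(y <- factors n.+1 | infix w (behead y)) branching y.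
  apply: eq_bigl => -[|a y]; first by rewrite andbb.
  by rewrite infix_consl; case: (infix w y); rewrite ?orbT ?andbF.
rewrite lerD ?sum_branching_left //.
by rewrite [leRHS](@eq_sum_factors _ _ (only_prefix w)) // => -[].
Qed.

(** * Bounds on the number of return words *)

(** The choice of [N] makes the tree finite. At length [size w + N] no factor avoids [w], so the sum
    over words without [w] vanishes and the sum over words containing [w] runs over all factors. *)
Lemma return_words_bounds w N : factor u w ->
  (forall y, factor u y -> (N <= size y)%N -> infix w y) ->
  exists r, [/\ (return_words u w #= `I_r)%card,
    (complexity u (size w).+1)%:Z - (complexity u (size w))%:Z <= r%:Z - 1 &
    r%:Z - 1 <=
    (complexity u (size w + N).+1)%:Z - (complexity u (size w + N))%:Z].
Proof.
move=> fw infw.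
(* The bound uses [N.+1] because [infw] is applied to the tail of [y], one letter shorter. *)
have bound y : factor u y -> only_prefix w y -> (size y < size w + N.+1)%N.
  case: y => [|a y] fy /=; first by rewrite addnS.
  move=> /andP[_ nwy]; rewrite addnS !ltnS ltnNge.
  apply: contra nwy => yN; apply: infw; first exact: (factor_behead fy).
  lia.
pose D k := \sum_(y <- factors (size w + k) | only_prefix w y) branching y.
(* Level [N + 1] has no node, so only the leaves and the root remain. *)
have DE : \sum_(k < N.+1) D k = (size (complete_returns w N.+1))%:Z - 1.
  rewrite sum_branching_only_prefix //.
  rewrite (@eq_in_count _ _ pred0) ?count_pred0 ?add0r // => y.
  rewrite mem_factors => /andP[/eqP yN /asboolP fy].
  by apply/negP => /(bound _ fy); rewrite yN ltnn.
exists (size (complete_returns w N.+1)); rewrite -DE.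
split; first exact: card_return_words.
- rewrite -sum_branching_factors.
  (* After [K] extensions to the left, the words that have met [w] are counted in some [D k], the
     others in the first sum. *)
  suff lb K : \sum_(y <- factors (size w)) branching y <=
      \sum_(y <- factors (size w + K) | ~~ infix w y) branching y
      + \sum_(k < K.+1) D k.
    apply: le_trans (lb N) _.
    rewrite (@eq_sum_factors _ _ pred0) ?big_pred0_eq ?add0r // => y yN fy.
    by rewrite infw // yN leq_addl.
  elim: K => [|K IHK].
    rewrite big_ord1 /D addn0 (bigID (only_prefix w)) /= addrC.
    rewrite (@eq_sum_factors _ (predC (infix w)) (predC (only_prefix w))) //.
    by move=> y yw _; rewrite /= infix_only_prefix_size.
  apply: le_trans IHK _; rewrite [X in _ <= _ + X]big_ord_recr /=.
  rewrite addrCA [X in _ <= X]addrC [X in X <= _]addrC addrC lerD2r.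
  by rewrite /D addnS; exact: sum_branching_free_le.
rewrite -sum_branching_factors.
(* Each new level [D K.+1] is disjoint from the left extensions of the words already containing
   [w]. *)
suff ub K : \sum_(k < K.+1) D k <=
    \sum_(y <- factors (size w + K) | infix w y) branching y.
  apply: le_trans (ub N) _; rewrite (@eq_sum_factors _ _ xpredT) // => y yN fy.
  by rewrite infw // yN leq_addl.
elim: K => [|K IHK].
  rewrite big_ord1 /D addn0 (@eq_sum_factors _ _ (only_prefix w)) // => y yw _.
  exact: infix_only_prefix_size.
rewrite big_ord_recr /= [D K.+1]/D addnS.
by apply: le_trans (sum_branching_infix_le w _); rewrite lerD2r.
Qed.

Lemma complexity_convex n :
  (complexity u n.+1)%:Z - (complexity u n)%:Z <=
  (complexity u n.+2)%:Z - (complexity u n.+1)%:Z.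
Proof.
by rewrite -!sum_branching_factors; exact: (sum_branching_left n xpredT).
Qed.

End Factors.

(* The complexity formula is stated in int, so that m - 1 is not truncated
   at m = 0. *)
Theorem theorem4p5 (A : finType) (u : nat -> A) (m : nat)
  (u_rec : uniformly_recurrent u)
  (u_noweak : forall w : seq A, ~ weak_bispecial u w) :
  property_R u m <->
  (forall n : nat, ((complexity u n)%:Z = (m%:Z - 1) * n%:Z + 1)%R).
Proof.
split=> [Rm | Cm w fw]; last first.
  have [N infw] := u_rec (size w).
  have [y fy Ny|r [rw lb ub]] := return_words_bounds u_noweak fw (N := N).
    exact: infw.
  (* Under the formula both increments equal [m - 1], so the two bounds force [r = m]. *)
  have -> : m = r by move: lb ub; rewrite !Cm; lia.
  exact: rw.
pose s n := ((complexity u n.+1)%:Z - (complexity u n)%:Z)%R.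
(* The lower bound on return words, applied to the prefix of [u] of length [n]. *)
have s_le n : (s n <= m%:Z - 1)%R.
  have [N infw] := u_rec n; set w := subword u 0 n.
  have wn : size w = n by exact: size_subword.
  have fw : factor u w by exact: factor_subword.
  have [y fy Ny|r [rw lb _]] := return_words_bounds u_noweak fw (N := N).
    exact: infw.
  have := card_eq_trans (card_esym (Rm w fw)) rw.
  by move/card_eq_II => ->; move: lb; rewrite wn.
(* The empty word with [N = 0] gives the case [n = 0]; convexity carries it to all [n]. *)
have s_ge n : (m%:Z - 1 <= s n)%R.
  elim: n => [|n IHn]; last exact: le_trans IHn (complexity_convex u_noweak n).
  have f0 : factor u [::] by exact: (factor_subword u 0 0).
  have [y _ _|r [rw _ ub]] := return_words_bounds u_noweak f0 (N := 0).
    exact: infix0s.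
  by have := card_eq_trans (card_esym (Rm _ f0)) rw => /card_eq_II ->.
elim=> [|n IHn]; first by rewrite complexity0 mulr0 add0r.
have /eqP : s n = (m%:Z - 1)%R by apply/le_anti/andP.
by rewrite /s subr_eq => /eqP ->; rewrite IHn; lia.
Qed.
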